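(* Let $F$ be a nonarchimedean local field and $G_n=GL(n,F)$. Let $\pi$ be a generic representation of $G_n$, let $L$ be a maximal (proper) Levi subgroup of $G_n$, and let $\mu$ be a character of $L$ such that $\pi$ is $(L,\mu)$-distinguished. Then $L\simeq M_{(n/2,n/2)}$ if $n$ is even, and $L\simeq M_{((n+1)/2,(n-1)/2)}$ if $n$ is odd.
   Context: All representations are smooth and complex; a character is a smooth homomorphism to $\mathbb{C}^*$. Let $N_n$ be the group of upper triangular unipotent matrices in $G_n$, fix a nontrivial character $\theta$ of $(F,+)$ and denote again by $\theta$ the character $x\mapsto\theta(\sum_{i=1}^{n-1}x_{i,i+1})$ of $N_n$. A generic representation of $G_n$ is an irreducible representation admitting an embedding in the (full smooth) induced representation $\mathrm{Ind}_{N_n}^{G_n}(\theta)$. For a closed subgroup $H$ of $G_n$ and a character $\chi$ of $H$, a representation $\pi$ of $G_n$ is $(H,\chi)$-distinguished if $\mathrm{Hom}_H(\pi,\chi)\neq 0$. For $p+q=n$, $M_{(p,q)}$ is the standard Levi subgroup of block diagonal matrices $\mathrm{diag}(h_p,h_q)$ with $h_p\in G_p$, $h_q\in G_q$. A maximal Levi subgroup of $G_n$ is a subgroup conjugate to some $M_{(p,q)}$ with $p+q=n$, $p\ge q\ge 1$. *)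

(* Defs.v *)
From HB Require Import structures.
From mathcomp Require Import all_boot all_order all_algebra.
From mathcomp Require Import complex.
From mathcomp Require Import boolp classical_sets functions reals.
From mathcomp Require Import topology normedtype.

Set Implicit Arguments.
Unset Strict Implicit.
Unset Printing Implicit Defensive.

Import Order.TTheory GRing.Theory Num.Theory.
Import numFieldNormedType.Exports.

Local Open Scope classical_set_scope.
Local Open Scope ring_scope.

(* A nonarchimedean local field, as a nondiscrete locally compact field whose  *)
(* topology is that of an ultrametric absolute value (not required to be the   *)
(* normalized one).                                                            *)
HB.mixin Record isNonarchLocalField (R : realType) F
    & GRing.Field F & Topological F := {
  absF : F -> R ;
  absF_ge0 : forall x, 0 <= absF x ;
  absF_eq0 : forall x, absF x = 0 <-> x = 0 ;
  absFM : forall x y, absF (x * y) = absF x * absF y ;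
  absF_ultra : forall x y, absF (x + y) <= Num.max (absF x) (absF y) ;
  absF_nontrivial : exists2 x, x != 0 & absF x != 1 ;
  nbhs_absF : forall x : F,
    nbhs x = filter_from [set e : R | 0 < e]
                         (fun e => [set y | absF (x - y) < e]) ;
  locally_compactF : locally_compact [set: F]
}.

#[short(type="nonarchLocalFieldType")]
HB.structure Definition NonarchLocalField (R : realType) :=
  {F of GRing.Field F & Topological F & isNonarchLocalField R F}.

Section GL.
Variables (n : nat) (F : fieldType).

Record GL := MkGL { GLmx :> 'M[F]_n ; GLmx_unit : GLmx \in unitmx }.

HB.instance Definition _ := [isSub for GLmx].
HB.instance Definition _ := [Choice of GL by <:].

Definition GL_mul (g h : GL) : GL :=
  @MkGL (GLmx g *m GLmx h)
    (etrans (unitmx_mul _ _) (introT andP (conj (GLmx_unit g) (GLmx_unit h)))).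
Definition GL_one : GL := @MkGL 1%:M (unitmx1 _ _).
Definition GL_inv (g : GL) : GL :=
  @MkGL (invmx (GLmx g)) (etrans (unitmx_inv (GLmx g)) (GLmx_unit g)).

Fact GL_mulA : associative GL_mul.
Proof. by move=> x y z; apply/val_inj; rewrite /= mulmxA. Qed.
Fact GL_mul1 : left_id GL_one GL_mul.
Proof. by move=> x; apply/val_inj; rewrite /= mul1mx. Qed.
Fact GL_mul1r : right_id GL_one GL_mul.
Proof. by move=> x; apply/val_inj; rewrite /= mulmx1. Qed.
Fact GL_mulV : left_inverse GL_one GL_inv GL_mul.
Proof. by move=> x; apply/val_inj; rewrite /= mulVmx // GLmx_unit. Qed.
Fact GL_mulVr : right_inverse GL_one GL_inv GL_mul.
Proof. by move=> x; apply/val_inj; rewrite /= mulmxV // GLmx_unit. Qed.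

HB.instance Definition _ :=
  isGroup.Build GL GL_mulA GL_mul1 GL_mul1r GL_mulV GL_mulVr.

End GL.

Arguments GLmx {n F} _.

(* The subspace topology is the group topology of GL(n, F), as inversion is    *)
(* continuous on a topological field.                                          *)
HB.instance Definition _ (R : realType) (F : nonarchLocalFieldType R) n :=
  Topological.copy (GL n F) (initial_topology (@GLmx n F)).

Section Representations.
Variables (R : realType) (F : nonarchLocalFieldType R) (n : nat).
Local Notation C := R[i].
Local Notation G := (GL n F).

(* Only the values of a character of H on H itself are relevant. *)
Definition is_character (H : set G) (chi : G -> C) : Prop :=
  [/\ forall h, H h -> chi h != 0,
      forall h k, H h -> H k -> chi (h * k)%g = chi h * chi k &
      forall h, H h -> \forall k \near within H (nbhs h), chi k = chi h].

Definition is_additive_character (theta : F -> C) : Prop :=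
  [/\ forall x, theta x != 0,
      forall x y, theta (x + y) = theta x * theta y &
      forall x, \forall y \near x, theta y = theta x].

Definition nontrivial_additive_character (theta : F -> C) : Prop :=
  is_additive_character theta /\ exists x, theta x != 1.

Record smooth_rep (V : lmodType C) := SmoothRep {
  rep_act :> G -> {linear V -> V} ;
  rep_act1 : forall v, rep_act 1%g v = v ;
  rep_actM : forall g h v, rep_act (g * h)%g v = rep_act g (rep_act h v) ;
  rep_smooth : forall v, open [set g | rep_act g v = v]
}.

Definition irreducible_rep (V : lmodType C) (rho : smooth_rep V) : Prop :=
  (exists v : V, v != 0) /\
  forall W : {pred V}, submod_closed W ->
    (forall g v, v \in W -> rho g v \in W) ->
    (forall v, v \in W -> v = 0) \/ (forall v, v \in W).

Definition distinguished (V : lmodType C) (rho : smooth_rep V)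
    (H : set G) (chi : G -> C) : Prop :=
  exists l : {linear V -> C^o},
    (forall h v, H h -> l (rho h v) = chi h * l v) /\ (exists v, l v != 0).

Definition unipotent_upper : set G :=
  [set u | forall i j : 'I_n, (j <= i)%N -> u i j = (i == j)%:R].

Definition unipotent_char (theta : F -> C) (u : G) : C :=
  theta (\sum_(i < n) \sum_(j < n | val j == (val i).+1) u i j).

Definition right_translate (g : G) (f : G -> C^o) : G -> C^o :=
  fun x => f (x * g)%g.

(* The space of the full smooth induced representation from the unipotent      *)
(* upper triangular subgroup, on which the group acts by right_translate.      *)
Definition Ind_unipotent (theta : F -> C) : set (G -> C^o) :=
  [set f | (forall u x, unipotent_upper u ->
              f (u * x)%g = unipotent_char theta u * f x) /\
           open [set g | right_translate g f = f]].

Definition generic_rep (theta : F -> C) (V : lmodType C) (rho : smooth_rep V)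
    : Prop :=
  irreducible_rep rho /\
  exists T : {linear V -> (G -> C^o)},
    [/\ injective T,
        forall v, Ind_unipotent theta (T v) &
        forall g v, T (rho g v) = right_translate g (T v)].

End Representations.

Section Levi.
Variables (F : fieldType) (n : nat).
Local Notation G := (GL n F).

(* Empty unless p + q = n. *)
Definition std_levi (p q : nat) : set G :=
  [set g | exists (e : (p + q)%N = n) (hp : GL p F) (hq : GL q F),
     GLmx g = castmx (e, e) (block_mx (GLmx hp) 0 0 (GLmx hq))].

Definition conjugate_to (L M : set G) : Prop :=
  exists g : G, L = [set (g * m * g^-1)%g | m in M].

(* For Levi subgroups, isomorphic is understood as conjugate in G, which is    *)
(* the equivalence classifying them; in particular it gives an isomorphism of  *)
(* groups.                                                                     *)
Lemma conjugate_to_isom (L M : set G) : conjugate_to L M ->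
  exists f : G -> G, set_bij M L f /\ forall x y, f (x * y)%g = (f x * f y)%g.
Proof.
case=> g ->; exists (fun m => (g * m * g^-1)%g); split; last first.
  by move=> x y; rewrite !mulgA mulgVK.
split=> [m Mm | x y _ _ | _ [m Mm <-]].
- by exists m.
- by move=> /mulIg /mulgI.
- by exists m.
Qed.

Definition maximal_levi (L : set G) : Prop :=
  exists p q : nat,
    [/\ (p + q)%N = n, (q <= p)%N, (1 <= q)%N & conjugate_to L (std_levi p q)].

End Levi.

(* Main.v *)
(** Suppose [L] stabilises a decomposition [U + U'] with [dim U >= dim U' + 2].
    For a small [t], averaging a vector on which the Whittaker functional does
    not vanish gives, after a diagonal translation, an eigenvector for the
    congruence subgroup [1 + t M_n(O)] with eigencharacter
    [1 + X |-> theta (a * tr (J X))], where [J] is the regular nilpotent lower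
    shift and [a * t] is large; it is nonzero because each congruence matrix
    factors into an upper unipotent and a lower triangular one, the latter
    fixing the averaged vector after translation. By irreducibility the
    [(L, mu)]-equivariant functional does not vanish on some translate of this
    eigenvector, so the eigencharacter agrees with a conjugate of [mu] on the
    intersection with a conjugate of [L]. But [mu] is trivial on the
    transvections of [U], and this forces [J - alpha], for some integral scalar
    [alpha], to be residually zero as a bilinear form on vectors of [U] and
    covectors killing [U'], contradicting that its residual corank is at most 1. *)
Require Import Defs.
From mathcomp Require Import all_boot all_order all_algebra complex.
From mathcomp Require Import boolp classical_sets reals.
From mathcomp Require Import cardinality topology.
From mathcomp Require Import perm ring zify.

Set Implicit Arguments.
Unset Strict Implicit.
Unset Printing Implicit Defensive.

Import Order.TTheory GRing.Theory Num.Theory.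

Local Open Scope classical_set_scope.
Local Open Scope ring_scope.

(** * Ultrametric absolute value of [F] *)

Section AbsoluteValue.
Variables (R : realType) (F : nonarchLocalFieldType R).
Implicit Types (x y : F) (c : R).
Local Notation absF := (@absF R F).

Lemma absF0 : absF 0 = 0.
Proof. exact/absF_eq0. Qed.

Lemma absF_gt0 x : x != 0 -> 0 < absF x.
Proof.
move=> x0; rewrite lt0r absF_ge0 andbT; apply: contra_neq x0.
by move/absF_eq0.
Qed.

Lemma absF1 : absF 1 = 1.
Proof.
have h : absF 1 != 0 by rewrite gt_eqF // absF_gt0 ?oner_neq0.
by apply: (mulfI h); rewrite -absFM !mulr1.
Qed.

Lemma absFN x : absF (- x) = absF x.
Proof.
rewrite -mulN1r absFM; suff -> : absF (-1) = 1 by rewrite mul1r.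
apply/eqP; rewrite -(@eqrXn2 _ 2) ?absF_ge0 ?ler01 //.
by rewrite expr2 -absFM mulrNN mulr1 absF1 expr1n.
Qed.

Lemma absFV x : absF x^-1 = (absF x)^-1.
Proof.
have [->|x0] := eqVneq x 0; first by rewrite invr0 absF0 invr0.
have ax : absF x != 0 by rewrite gt_eqF ?absF_gt0.
by apply: (mulfI ax); rewrite -absFM !divff ?absF1.
Qed.

Lemma absFX x k : absF (x ^+ k) = absF x ^+ k.
Proof. by elim: k => [|k IH]; rewrite ?expr0 ?absF1 // !exprS absFM IH. Qed.

Lemma absF_prod I (r : seq I) (P : pred I) (f : I -> F) :
  absF (\prod_(i <- r | P i) f i) = \prod_(i <- r | P i) absF (f i).
Proof. exact: (big_morph absF absFM absF1). Qed.

Lemma absFD_le c x y : absF x <= c -> absF y <= c -> absF (x + y) <= c.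
Proof. by move=> hx hy; rewrite (le_trans (absF_ultra _ _)) // ge_max hx. Qed.

Lemma absFD_lt c x y : absF x < c -> absF y < c -> absF (x + y) < c.
Proof. by move=> hx hy; rewrite (le_lt_trans (absF_ultra _ _)) // gt_max hx. Qed.

Lemma absFB_lt c x y : absF x < c -> absF y < c -> absF (x - y) < c.
Proof. by move=> hx hy; apply: absFD_lt; rewrite ?absFN. Qed.

Lemma absF_sum_le c I (r : seq I) (P : pred I) (f : I -> F) : 0 <= c ->
  (forall i, P i -> absF (f i) <= c) -> absF (\sum_(i <- r | P i) f i) <= c.
Proof.
move=> c0 h; elim/big_ind: _ => //; first by rewrite absF0.
exact: absFD_le.
Qed.

Lemma absF_sum_lt c I (r : seq I) (P : pred I) (f : I -> F) : 0 < c ->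
  (forall i, P i -> absF (f i) < c) -> absF (\sum_(i <- r | P i) f i) < c.
Proof.
move=> c0 h; elim/big_ind: _ => //; first by rewrite absF0.
exact: absFD_lt.
Qed.

Lemma absFM_le c d x y :
  absF x <= c -> absF y <= d -> absF (x * y) <= c * d.
Proof. by move=> hx hy; rewrite absFM ler_pM ?absF_ge0. Qed.

(** If [1 + x] were small too, so would be [1 = (1 + x) - x], by the ultrametric inequality. *)
Lemma absF_add1 x : absF x < 1 -> absF (1 + x) = 1.
Proof.
move=> hx; apply/eqP; rewrite eq_le absFD_le ?absF1 ?(ltW hx) //=.
rewrite leNgt; apply/negP => h.
by have := absFB_lt h hx; rewrite addrK absF1 ltxx.
Qed.

Lemma absF_add1_neq0 x : absF x < 1 -> 1 + x != 0.
Proof.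
move=> hx; apply/eqP => h; have := absF_add1 hx.
by rewrite h absF0 => /eqP; rewrite eq_sym oner_eq0.
Qed.

(** Nontriviality gives a nonzero [x] with [absF x < 1], after inversion if necessary; its powers
    tend to 0 by Bernoulli's inequality and the Archimedean property. *)
Lemma exists_small_absF c : 0 < c -> exists2 x, x != 0 & absF x < c.
Proof.
move=> c0.
have [x x0 hx] : exists2 x, x != 0 & absF x < 1.
  have [x x0 x1] := @absF_nontrivial R F.
  have [lt|gt] := ltrP (absF x) 1; first by exists x.
  exists x^-1; rewrite ?invr_eq0 // absFV invf_lt1 ?absF_gt0 //.
  by rewrite lt_neqAle eq_sym x1.
have [k hk] : exists k, absF x ^+ k < c.
  have ax := absF_gt0 x0.
  have e0 : 0 < (absF x)^-1 - 1 by rewrite subr_gt0 invf_gt1.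
  set e := (absF x)^-1 - 1 in e0.
  have [k hk] : exists k, c^-1 < k%:R * e.
    exists (Num.bound (c^-1 / e)); rewrite -ltr_pdivrMr //.
    by apply: archi_boundP; rewrite divr_ge0 ?invr_ge0 ?ltW.
  exists k; rewrite -[c]invrK -[absF x ^+ k]invrK ltf_pV2 ?posrE ?invr_gt0 ?exprn_gt0 //.
  apply: (lt_le_trans hk).
  have -> : (absF x ^+ k)^-1 = (1 + e) ^+ k by rewrite /e addrC subrK exprVn.
  have bern j : j%:R * e <= (1 + e) ^+ j.
    elim: j => [|j IH]; first by rewrite mul0r expr0.
    rewrite exprS mulrDl mul1r -natr1 mulrDl mul1r lerD // ler_peMr ?(ltW e0) //.
    by rewrite exprn_ege1 // lerDl ltW.
  exact: bern.
by exists (x ^+ k); rewrite ?expf_eq0 ?(negPf x0) ?andbF // absFX.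
Qed.

End AbsoluteValue.

(** * Integral matrices, small determinants and the Smith form *)

Section IntegralMatrices.
Variables (R : realType) (F : nonarchLocalFieldType R).
Implicit Types (c : R).
Local Notation absF := (@absF R F).

Definition mx_le c m n (A : 'M[F]_(m, n)) := forall i j, absF (A i j) <= c.

Lemma mulmx_le c d m n p (A : 'M[F]_(m, n)) (B : 'M[F]_(n, p)) :
  0 <= c -> 0 <= d -> mx_le c A -> mx_le d B -> mx_le (c * d) (A *m B).
Proof.
move=> c0 d0 hA hB i j; rewrite mxE absF_sum_le ?mulr_ge0 // => k _.
exact: absFM_le.
Qed.

Lemma mulmx_le1 m n p (A : 'M[F]_(m, n)) (B : 'M[F]_(n, p)) :
  mx_le 1 A -> mx_le 1 B -> mx_le 1 (A *m B).
Proof. by move=> hA hB; rewrite -[X in mx_le X]mulr1; apply: mulmx_le. Qed.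

Lemma addmx_le c m n (A B : 'M[F]_(m, n)) :
  mx_le c A -> mx_le c B -> mx_le c (A + B).
Proof. by move=> hA hB i j; rewrite mxE absFD_le. Qed.

Lemma mx_le_weaken c d m n (A : 'M[F]_(m, n)) :
  c <= d -> mx_le c A -> mx_le d A.
Proof. by move=> cd hA i j; apply: le_trans cd. Qed.

Lemma scalemx_le c x m n (A : 'M[F]_(m, n)) :
  mx_le c A -> mx_le (absF x * c) (x *: A).
Proof. by move=> hA i j; rewrite mxE absFM ler_wpM2l ?absF_ge0. Qed.

Lemma mx_le1 n : mx_le 1 (1%:M : 'M[F]_n).
Proof.
by move=> i j; rewrite mxE; case: eqP => _; rewrite ?absF1 ?absF0 ?ler01.
Qed.

Lemma mx_le_perm n (s : 'S_n) : mx_le 1 (perm_mx s : 'M[F]_n).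
Proof.
by move=> i j; rewrite !mxE; case: eqP => _; rewrite ?absF1 ?absF0 ?ler01.
Qed.

Lemma mx_le_block c m1 m2 n1 n2 (A : 'M[F]_(m1, n1)) (B : 'M_(m1, n2))
    (C : 'M_(m2, n1)) (D : 'M_(m2, n2)) :
  mx_le c A -> mx_le c B -> mx_le c C -> mx_le c D ->
  mx_le c (block_mx A B C D).
Proof.
move=> hA hB hC hD i j.
by case: (split_ordP i) => i' ->; case: (split_ordP j) => j' ->;
  rewrite (block_mxEul, block_mxEur, block_mxEdl, block_mxEdr).
Qed.

Lemma mx_le0 c m n : 0 <= c -> mx_le c (0 : 'M[F]_(m, n)).
Proof. by move=> c0 i j; rewrite mxE absF0. Qed.

(* Each permutation sends some row of [A] to a column of [B], so every term of *)
(* the Leibniz formula has a factor of absolute value less than 1.             *)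
Lemma absF_det_lt1 n (M : 'M[F]_n) (A B : {set 'I_n}) : mx_le 1 M ->
  (forall i j, i \in A -> j \in B -> absF (M i j) < 1) ->
  (n < #|A| + #|B|)%N -> absF (\det M) < 1.
Proof.
move=> hM hAB hn; rewrite absF_sum_lt ?ltr01 // => s _.
rewrite absFM absFX absFN absF1 expr1n mul1r absF_prod.
have [i iA siB] : exists2 i, i \in A & s i \in B.
  apply/exists_inP; apply: contraLR hn => /exists_inPn h.
  rewrite -leqNgt -[n in leqRHS]card_ord -(cardsC B) addnC leq_add2l.
  rewrite -(card_imset A (@perm_inj _ s)) subset_leq_card //.
  by apply/fintype.subsetP => _ /imsetP[i iA ->]; rewrite inE h.
rewrite (bigD1 i) //=.
have h1 : \prod_(j < n | j != i) absF (M j (s j)) <= 1.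
  by apply: prodr_ile1 => j _; rewrite absF_ge0 hM.
apply: le_lt_trans (hAB _ _ iA siB).
by rewrite ler_piMr ?absF_ge0.
Qed.

(** These are the elements of GL(n, O), for O the ring of integers of [F]. *)
Definition unimodular n (A : 'M[F]_n) := mx_le 1 A /\ absF (\det A) = 1.

Lemma unimodular1 n : unimodular (1%:M : 'M[F]_n).
Proof. by split; [exact: mx_le1 | rewrite det1 absF1]. Qed.

Lemma unimodularM n (A B : 'M[F]_n) :
  unimodular A -> unimodular B -> unimodular (A *m B).
Proof.
move=> [hA dA] [hB dB]; split; last by rewrite det_mulmx absFM dA dB mulr1.
exact: mulmx_le1.
Qed.

Lemma unimodular_tperm n (i j : 'I_n) : unimodular (tperm_mx i j : 'M[F]_n).
Proof.
split; first exact: mx_le_perm.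
by rewrite det_perm absFX absFN absF1 expr1n.
Qed.

Lemma unimodular_unit n (A : 'M[F]_n) : unimodular A -> A \in unitmx.
Proof.
case=> _ dA; rewrite unitmxE unitfE; apply/eqP => h; move: dA.
by rewrite h absF0 => /eqP; rewrite eq_sym oner_eq0.
Qed.

Lemma tperm_mxK n (i j : 'I_n) : tperm_mx i j *m tperm_mx i j = 1%:M :> 'M[F]_n.
Proof. by rewrite -perm_mxM tperm2 perm_mx1. Qed.

(* The pivot is an entry of largest absolute value, so that all quotients by   *)
(* it are integral.                                                            *)
Lemma smith_form n (A : 'M[F]_n) : exists k1 k2 (d : 'rV[F]_n),
  [/\ unimodular k1, unimodular k2 & A = k1 *m diag_mx d *m k2].
Proof.
elim: n A => [|n IH] A.
  exists 1%:M, 1%:M, 0; split; try exact: unimodular1.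
  by apply/matrixP => -[].
have [A0|] := pselect (A = 0).
  exists 1%:M, 1%:M, 0; split; try exact: unimodular1.
  by rewrite A0 linear0 mul1mx mulmx1.
move=> /eqP /matrix0Pn[i1 [j1 A1]].
pose ij := [arg max_(u > ((i1, j1) : 'I_n.+1 * 'I_n.+1)) absF (A u.1 u.2)]%O.
have ijP u v : absF (A u v) <= absF (A ij.1 ij.2).
  by rewrite /ij; case: arg_maxP => // w _ /(_ (u, v)); apply.
have a0 : A ij.1 ij.2 != 0.
  apply: contraTneq (ijP i1 j1) => ->.
  by rewrite absF0 -ltNge absF_gt0.
have [B AB BE] : exists2 B : 'M[F]_(1 + n),
    A = tperm_mx 0 ij.1 *m B *m tperm_mx 0 ij.2 &
    forall i j, B i j = A (tperm 0 ij.1 i) (tperm 0 ij.2 j).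
  exists (tperm_mx 0 ij.1 *m A *m tperm_mx 0 ij.2).
    by rewrite -!mulmxA tperm_mxK mulmx1 !mulmxA tperm_mxK mul1mx.
  by move=> i j; rewrite -xrowE -xcolE !mxE.
pose a := A ij.1 ij.2.
have Ba : ulsubmx B = a%:M.
  apply/matrixP => i j; rewrite !ord1 !mxE eqxx mulr1n BE.
  by rewrite (_ : lshift n 0 = 0) ?tpermL //; apply/val_inj.
have hB i j : absF (B i j) <= absF a by rewrite BE ijP.
(* The induction runs on the Schur complement of the pivot. *)
have [l1 [l2 [d [u1 u2 hd]]]] := IH (drsubmx B - a^-1 *: (dlsubmx B *m ursubmx B)).
have hdiv x : absF x <= absF a -> absF (a^-1 * x) <= 1.
  by move=> hx; rewrite absFM absFV mulrC ler_pdivrMr ?absF_gt0 ?mul1r.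
have ublk m1 (l : 'M[F]_m1) (r : 'rV[F]_m1) : unimodular l -> mx_le 1 r ->
    unimodular (block_mx (1%:M : 'M_1) r 0 l).
  move=> [hl dl] hr; split; last by rewrite det_ublock det1 mul1r.
  by apply: mx_le_block => //; [exact: mx_le1 | exact: mx_le0].
have lblk m1 (l : 'M[F]_m1) (r : 'cV[F]_m1) : unimodular l -> mx_le 1 r ->
    unimodular (block_mx (1%:M : 'M_1) 0 r l).
  move=> [hl dl] hr; split; last by rewrite det_lblock det1 mul1r.
  by apply: mx_le_block => //; [exact: mx_le1 | exact: mx_le0].
exists (tperm_mx 0 ij.1 *m block_mx 1%:M 0 (a^-1 *: dlsubmx B) l1).
exists (block_mx 1%:M (a^-1 *: ursubmx B) 0 l2 *m tperm_mx 0 ij.2).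
exists (row_mx a%:M d); split.
- apply: unimodularM (unimodular_tperm _ _) _; apply: lblk => // i j.
  by rewrite !mxE hdiv.
- apply: unimodularM _ (unimodular_tperm _ _); apply: ublk => // i j.
  by rewrite !mxE hdiv.
have dE : diag_mx (row_mx a%:M d) = block_mx (a%:M : 'M_1) 0 0 (diag_mx d).
  rewrite diag_mx_row; congr block_mx.
  by apply/matrixP => i j; rewrite !ord1 !mxE.
have -> : A = tperm_mx 0 ij.1 *m
   ((block_mx 1%:M 0 (a^-1 *: dlsubmx B) l1 : 'M_(1 + n)) *m
     diag_mx (row_mx a%:M d) *m
     (block_mx 1%:M (a^-1 *: ursubmx B) 0 l2 : 'M_(1 + n))) *m tperm_mx 0 ij.2.
  rewrite {1}AB; congr (_ *m _ *m _).
  rewrite dE !mulmx_block !(mul0mx, mulmx0, addr0, add0r, mul1mx, mulmx1).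
  rewrite -[B in LHS](submxK B) Ba -hd mul_scalar_mx scalerA divff // scale1r.
  rewrite mul_mx_scalar scalerA divff // scale1r.
  by rewrite -scalemxAr addrC subrK.
by rewrite !mulmxA.
Qed.

End IntegralMatrices.

(** * The regular nilpotent shift and its restriction to the image of an idempotent *)

Section LowerShift.
Variables (R : realType) (F : nonarchLocalFieldType R).
Local Notation absF := (@absF R F).

Definition lower_shift n : 'M[F]_n := \matrix_(i, j) (val i == (val j).+1)%:R.

Lemma lower_shift_le1 n : mx_le 1 (lower_shift n).
Proof.
by move=> i j; rewrite mxE; case: eqP => _; rewrite ?absF1 ?absF0 ?ler01.
Qed.

(* Moving the first row to the bottom makes this matrix upper unitriangular,   *)
(* whatever [a] is.                                                            *)
Definition bordered_shift n (a : F) : 'M[F]_(1 + n) :=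
  block_mx 0 (\row_j (val j == n.-1)%:R) (\col_i (val i == 0)%:R)
    (lower_shift n - a%:M).

(** The first row has a single nonzero entry, in the last column; deleting both leaves an upper
    triangular minor with ones on the diagonal. *)
Lemma absF_det_bordered_shift n a :
  (0 < n)%N -> absF (\det (bordered_shift n a)) = 1.
Proof.
case: n => // n _.
have -> : bordered_shift n.+1 a = (\matrix_(i < n.+2, j < n.+2)
    if val i == 0 then (val j == n.+1)%:R
    else (val i == (val j).+1)%:R - a *+ (val i == val j)).
  apply/matrixP => i j; rewrite [RHS]mxE /bordered_shift.
  case: (split_ordP i) => i' ->; case: (split_ordP j) => j' ->;
  by rewrite (block_mxEul, block_mxEur, block_mxEdl, block_mxEdr) ?ord1 !mxE
     //= ?subr0.
rewrite (expand_det_row _ ord0) (bigD1 ord_max) //= big1 ?addr0; last first.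
  move=> j jm; rewrite mxE /=; case: eqP => [h|_]; last by rewrite mul0r.
  by case/eqP: jm; apply/val_inj.
rewrite mxE /= eqxx mul1r /cofactor absFM absFX absFN absF1 expr1n mul1r.
rewrite -det_tr det_trig.
  rewrite big1 ?absF1 // => i _; rewrite !mxE /= /bump /=.
  by rewrite add1n leqNgt ltn_ord add0n eqxx eqn_leq ltnn subr0.
apply/is_trig_mxP => i j lij; rewrite !mxE /= /bump /= add1n.
rewrite leqNgt ltn_ord add0n eqSS gtn_eqF // gtn_eqF ?subr0 //.
exact: leqW.
Qed.

(** The bordered matrix, of size [n.+1], stays unimodular after multiplication by [k2] and [k1]
    extended by 1, and contains the given block. If the block were small, [absF_det_lt1] would make
    its determinant small. *)
Lemma shift_block_not_small n (k1 k2 : 'M[F]_n) a (I : {set 'I_n}) :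
  unimodular k1 -> unimodular k2 -> absF a <= 1 -> (n.+1 < #|I| + #|I|)%N ->
  ~ (forall i j, i \in I -> j \in I ->
       absF ((k2 *m (lower_shift n - a%:M) *m k1) i j) < 1).
Proof.
move=> u1 u2 a1 hI hs.
have n0 : (0 < n)%N by have := max_card I; rewrite card_ord; lia.
have blk (k : 'M[F]_n) : unimodular k ->
    unimodular (block_mx (1%:M : 'M_1) 0 0 k).
  move=> [hk dk]; split; last by rewrite det_ublock det1 mul1r.
  by apply: mx_le_block => //; [exact: mx_le1 | exact: mx_le0 | exact: mx_le0].
have le1 (b : bool) : absF b%:R <= 1 by case: b; rewrite ?absF1 ?absF0 ?ler01.
have ub : unimodular (bordered_shift n a).
  split; last exact: absF_det_bordered_shift.
  apply: mx_le_block; try by move=> i j; rewrite !mxE ?absF0 ?ler01.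
  move=> i j; rewrite 2!mxE absFD_le ?lower_shift_le1 // !mxE absFN.
  by case: eqP => _; rewrite ?mulr0n ?absF0 ?ler01.
have uM := unimodularM (unimodularM (blk _ u2) ub) (blk _ u1).
have := @absF_det_lt1 _ _ _ _ [set rshift 1 i | i in I]%SET [set rshift 1 i | i in I]%SET
  uM.1.
rewrite uM.2 ltxx => h; suff: false by []; apply: h.
  move=> _ _ /imsetP[i iI ->] /imsetP[j jI ->].
  rewrite /bordered_shift !mulmx_block !(mul0mx, mulmx0, addr0, add0r, mul1mx, mulmx1).
  by rewrite block_mxEdr hs.
by rewrite card_imset //; exact: rshift_inj.
Qed.

Lemma rank_diag_mx_le n (d : 'rV[F]_n) :
  (\rank (diag_mx d) <= #|[set i | d 0%R i != 0%R]%SET|)%N.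
Proof.
have -> : diag_mx d = \sum_(i in [set i | d 0 i != 0]%SET) d 0 i *: delta_mx i i.
  rewrite diag_mx_sum_delta (bigID (mem [set i | d 0 i != 0]%SET)) /= addrC big1 ?add0r //.
  by move=> i; rewrite inE negbK => /eqP ->; rewrite scale0r.
rewrite -sum1_card; elim/big_ind2: _ => [|m A k B hA hB|i _]; first by rewrite mxrank0.
  exact: leq_trans (mxrank_add _ _) (leq_add hA hB).
by rewrite (leq_trans (mxrank_scale _ _)) // mxrank_delta.
Qed.

Lemma mul_row_mx_col n (A k1 k2 : 'M[F]_n) i j :
  (row j k2 *m A *m col i k1) 0 0 = (k2 *m A *m k1) j i.
Proof.
by rewrite -row_mul colE mulmxA -row_mul -colE 2!mxE.
Qed.

Lemma mulmx_combo n (A : 'M[F]_n) (y y' : 'rV[F]_n) (x x' : 'cV[F]_n) c :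
  ((y - c *: y') *m A *m (x + x')) 0 0 =
  (y *m A *m x) 0 0 + (y *m A *m x') 0 0
  - c * ((y' *m A *m x) 0 0 + (y' *m A *m x') 0 0).
Proof.
have D (B C : 'M[F]_1) : (B + C) 0 0 = B 0 0 + C 0 0 by rewrite mxE.
have N (B : 'M[F]_1) : (- B) 0 0 = - B 0 0 by rewrite mxE.
have S (B : 'M[F]_1) : (c *: B) 0 0 = c * B 0 0 by rewrite mxE.
by rewrite !mulmxBl !mulmxDr -!scalemxAl !(D, N, S); ring.
Qed.

(* In Smith coordinates the pairing between the integral vectors fixed by [P]  *)
(* and the integral covectors fixed by [P] is diagonal; if every orthogonal    *)
(* pair had a small value, [lower_shift] would be congruent on them to a       *)
(* multiple [a] of the pairing, so [lower_shift - a] would be residually zero  *)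
(* on a block too large for a matrix of residual corank at most 1.             *)
Lemma idempotent_witness n (P : 'M[F]_n) :
  P *m P = P -> (n.+1 < \rank P + \rank P)%N ->
  exists (u : 'cV[F]_n) (xi : 'rV[F]_n),
    [/\ mx_le 1 u, mx_le 1 xi, P *m u = u & xi *m P = xi] /\
    xi *m u = 0 /\ 1 <= absF ((xi *m lower_shift n *m u) 0 0).
Proof.
move=> PP hP; apply: contrapT => /forallNP H.
have {}H (u : 'cV[F]_n) (xi : 'rV[F]_n) : mx_le 1 u -> mx_le 1 xi ->
    P *m u = u -> xi *m P = xi -> (xi *m u) 0 0 = 0 ->
    absF ((xi *m lower_shift n *m u) 0 0) < 1.
  move=> hu hxi Pu xiP xu; rewrite ltNge; apply/negP => h.
  have /forallNP /(_ xi) := H u; apply; do !split => //.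
  by apply/matrixP => i j; rewrite !ord1 xu mxE.
have [k1 [k2 [d [u1 u2 hd]]]] := smith_form P.
have v1 := unimodular_unit u1; have v2 := unimodular_unit u2.
have uM := unimodularM u2 u1.
set M := k2 *m k1 in uM.
pose I := [set i | d 0 i != 0]%SET.
have cI : (n.+1 < #|I| + #|I|)%N.
  apply: leq_trans hP _; suff h : (\rank P <= #|I|)%N by exact: leq_add.
  rewrite hd (leq_trans (mxrankM_maxl _ _)) // (leq_trans (mxrankM_maxr _ _)) //.
  exact: rank_diag_mx_le.
(* This is [P *m P = P] with [k1] and [k2] cancelled; on [I] it makes [M] the inverse of the
   diagonal matrix [d]. *)
have DMD : diag_mx d *m M *m diag_mx d = diag_mx d.
  have := PP; rewrite {1 2 3}hd => h.
  apply: (can_inj (mulKmx v1)); apply: (can_inj (mulmxK v2)).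
  by rewrite -h /M !mulmxA.
have ME i j : i \in I -> j \in I -> M j i = (d 0 i)^-1 *+ (i == j).
  rewrite !inE => di dj; have /matrixP/(_ j i) := DMD.
  rewrite mul_mx_diag mul_diag_mx !mxE eq_sym => h.
  apply: (mulfI dj); apply: (mulIf di); rewrite h.
  have [->|_] := eqVneq i j; first by rewrite !mulr1n mulfV // mul1r.
  by rewrite !mulr0n mulr0 mul0r.
have Pcol i : i \in I -> P *m col i k1 = col i k1.
  rewrite inE => di.
  have -> : col i k1 = P *m ((d 0 i)^-1 *: col i (invmx k2)).
    rewrite -scalemxAr hd (colE i (invmx k2)) mulmxA mulmxK // -colE.
    by apply/matrixP => r c; rewrite mul_mx_diag !mxE mulrCA mulVf ?mulr1.
  by rewrite mulmxA PP.
have rowP i : i \in I -> row i k2 *m P = row i k2.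
  rewrite inE => di.
  have -> : row i k2 = ((d 0 i)^-1 *: row i (invmx k1)) *m P.
    rewrite -scalemxAl hd (rowE i (invmx k1)) !mulmxA mulmxKV // -mulmxA -rowE.
    by apply/matrixP => r c; rewrite mul_diag_mx !mxE mulrA mulVf ?mul1r.
  by rewrite -mulmxA PP.
have colle i : mx_le 1 (col i k1) by move=> a b; rewrite mxE u1.1.
have rowle i : mx_le 1 (row i k2) by move=> a b; rewrite mxE u2.1.
have pairE i j : (row j k2 *m col i k1) 0 0 = M j i.
  by rewrite -[row j k2]mulmx1 mul_row_mx_col mulmx1.
set N := k2 *m lower_shift n *m k1.
have NE i j : (row j k2 *m lower_shift n *m col i k1) 0 0 = N j i.
  exact: mul_row_mx_col.
(* Otherwise the block of [M] on [I] would be small, and too large for the unimodular [M]. *)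
have [i0 i0I hi0] : exists2 i0, i0 \in I & absF (d 0 i0) <= 1.
  apply: contrapT => /forallPNP h.
  suff: absF (\det M) < 1 by rewrite uM.2 ltxx.
  apply: (@absF_det_lt1 _ _ _ _ I I uM.1); last exact: ltnW.
  move=> j i jI iI; rewrite ME //; case: eqP => _; last by rewrite mulr0n absF0 ltr01.
  rewrite mulr1n absFV invf_lt1 ?absF_gt0 //; last by move: iI; rewrite inE.
  by rewrite ltNge; apply/negP => /h; apply.
have d1 i : i \in I -> 1 <= absF (d 0 i).
  move=> iI; have := uM.1 i i; rewrite ME // eqxx mulr1n absFV.
  by rewrite invf_le1 ?absF_gt0 //; move: iI; rewrite inE.
have ad0 : absF (d 0 i0) = 1 by apply/eqP; rewrite eq_le hi0 d1.
have dn0 i : i \in I -> d 0 i != 0 by rewrite inE.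
(* The scalar for which [N - a *: M] vanishes at [(i0, i0)]. *)
pose a := N i0 i0 * d 0 i0.
have N1 : mx_le 1 N.
  exact: mulmx_le1 (mulmx_le1 u2.1 (@lower_shift_le1 n)) u1.1.
have a1 : absF a <= 1 by rewrite /a absFM ad0 mulr1 N1.
apply: (shift_block_not_small u1 u2 a1 cI) => j i jI iI.
have -> : (k2 *m (lower_shift n - a%:M) *m k1) j i = N j i - a * M j i.
  rewrite mulmxBr mulmxBl -/N mul_mx_scalar -scalemxAl -/M.
  by rewrite [LHS]mxE [X in _ + X]mxE [X in - X]mxE.
rewrite ME //.
have [eij|nij] := eqVneq i j; last first.
  by rewrite mulr0n mulr0 subr0 -NE H ?Pcol ?rowP // pairE ME // (negPf nij).
rewrite mulr1n -{j jI}eij; have [->|ni] := eqVneq i i0.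
  by rewrite /a mulfK ?dn0 // subrr absF0 ltr01.
(* With this [c], the covector [row i k2 - c *: row i0 k2] kills [col i0 k1 + col i k1]. Applying
   [H] to this pair compares the diagonal entries of [N] at [i] and [i0]. *)
set c := d 0 i0 / d 0 i.
have c1 : absF c <= 1.
  by rewrite absFM absFV ad0 mul1r invf_le1 ?d1 ?absF_gt0 ?dn0.
have := H (col i0 k1 + col i k1) (row i k2 - c *: row i0 k2).
have -> : ((row i k2 - c *: row i0 k2) *m (col i0 k1 + col i k1)) 0 0 = 0.
  rewrite -[X in X *m _]mulmx1 mulmx_combo !mulmx1 !pairE.
  rewrite !ME // !eqxx !(eq_sym i0) (negPf ni) !mulr1n !mulr0n.
  by rewrite /c addr0 add0r mulrAC divff ?dn0 // mul1r subrr.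
have -> : ((row i k2 - c *: row i0 k2) *m lower_shift n *m (col i0 k1 + col i k1)) 0 0
   = (N i i - c * N i0 i0) + (N i i0 - c * N i0 i).
  by rewrite mulmx_combo !NE; ring.
move=> h.
have -> : N i i - a / d 0 i = N i i - c * N i0 i0 by rewrite /a /c; ring.
rewrite -[X in absF X](addrK (N i i0 - c * N i0 i)); apply: absFB_lt.
  apply: h => //.
  - exact: addmx_le.
  - move=> x y; rewrite mxE absFD_le ?rowle // mxE absFN mxE -[1]mulr1.
    exact: absFM_le (c1) (rowle _ _ _).
  - by rewrite mulmxDr !Pcol.
  - by rewrite mulmxBl -scalemxAl !rowP.
have o j k : j \in I -> k \in I -> k != j -> absF (N j k) < 1.
  by move=> jI kI njk; rewrite -NE H ?Pcol ?rowP // pairE ME // (negPf njk).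
apply: absFB_lt; first by apply: o; rewrite // eq_sym.
by rewrite absFM; apply: le_lt_trans (o _ _ i0I iI ni); rewrite ler_piMl ?absF_ge0.
Qed.

End LowerShift.

(** * Characters of the centralizer of an idempotent are trivial on transvections of its image *)

Section Transvections.
Variables (F : fieldType) (K : idomainType) (n : nat) (P : 'M[F]_n).
Variable chi : GL n F -> K.

(** For an idempotent [P], this is the Levi subgroup stabilising the image and the kernel of [P]. *)
Definition mx_centralizer : set (GL n F) :=
  [set g | GLmx g *m P = P *m GLmx g].

Hypothesis idemP : P *m P = P.
Hypothesis chi_neq0 : forall g, mx_centralizer g -> chi g != 0.
Hypothesis chiM : forall g h, mx_centralizer g -> mx_centralizer h ->
  chi (g * h)%g = chi g * chi h.

Lemma GLmx_inj : injective (@GLmx n F).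
Proof. exact: val_inj. Qed.

Lemma transvection_unit (u : 'cV[F]_n) (xi : 'rV[F]_n) :
  xi *m u = 0 -> 1%:M + u *m xi \in unitmx.
Proof.
move=> xu; suff /mulmx1_unit[] : (1%:M + u *m xi) *m (1%:M - u *m xi) = 1%:M by [].
rewrite mulmxDl mul1mx mulmxBr mulmx1 mulmxA -[u *m xi *m u]mulmxA xu.
by rewrite mulmx0 mul0mx subr0 subrK.
Qed.

(* A transvection [1 + u xi] is conjugate to [1 + c u xi] for all [c != 0], so *)
(* its value [z] satisfies [z = z * z] as soon as [c] and [1 + c] are nonzero. *)
Lemma character_transvection (x : F) (u : 'cV[F]_n) (xi : 'rV[F]_n) (g : GL n F) :
  x != 0 -> 1 + x != 0 -> P *m u = u -> xi *m P = xi -> xi *m u = 0 ->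
  GLmx g = 1%:M + u *m xi -> chi g = 1.
Proof.
move=> x0 x1 Pu xiP xu gE.
have Z1 : mx_centralizer 1%g by rewrite /mx_centralizer /= mul1mx mulmx1.
have chi1 : chi 1%g = 1 by apply: (mulfI (chi_neq0 Z1)); rewrite -chiM // mulg1 mulr1.
have [u0|un0] := eqVneq u 0.
  suff -> : g = 1%g by [].
  by apply: GLmx_inj; rewrite gE u0 mul0mx addr0.
have [w [wP wu]] : exists w : 'rV[F]_n, w *m P = w /\ w *m u = 1%:M.
  have /matrix0Pn[i [j uij]] := un0.
  exists ((u i 0)^-1 *: delta_mx 0 i *m P).
  rewrite -!mulmxA idemP Pu; split=> //; rewrite -scalemxAl -rowE.
  apply/matrixP => a b; rewrite !ord1 !mxE eqxx mulVf //.
  by move: uij; rewrite (ord1 j).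
pose U := u *m xi; pose W := u *m w.
have UU : U *m U = 0 by rewrite /U mulmxA -[u *m xi *m u]mulmxA xu mulmx0 mul0mx.
have UW : U *m W = 0 by rewrite /U /W mulmxA -[u *m xi *m u]mulmxA xu mulmx0 mul0mx.
have WU : W *m U = U by rewrite /U /W mulmxA -[u *m w *m u]mulmxA wu mulmx1.
have WW : W *m W = W by rewrite /W mulmxA -[u *m w *m u]mulmxA wu mulmx1.
have PU : P *m U = U /\ U *m P = U by rewrite /U mulmxA Pu -mulmxA xiP.
have PW : P *m W = W /\ W *m P = W by rewrite /W mulmxA Pu -mulmxA wP.
have tE a : exists2 t : GL n F, GLmx t = 1%:M + a *: U & mx_centralizer t.
  have ut : 1%:M + a *: U \in unitmx.
    by rewrite /U scalemxAl transvection_unit // -scalemxAr xu scaler0.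
  exists (MkGL ut) => //; rewrite /mx_centralizer /= mulmxDl mulmxDr mul1mx mulmx1.
  by rewrite -scalemxAl -scalemxAr PU.1 PU.2.
(* As [W] is the projector onto the line of [u] along the kernel of [w], this element scales [u] by
   [c]; it conjugates [1 + U] to [1 + c U]. *)
have dE c : c != 0 -> exists2 t : GL n F,
    GLmx t = 1%:M + (c - 1) *: W & mx_centralizer t.
  move=> c0.
  have /mulmx1_unit[ut _] :
      (1%:M + (c - 1) *: W) *m (1%:M + (c^-1 - 1) *: W) = 1%:M.
    rewrite mulmxDl mul1mx mulmxDr mulmx1 -scalemxAl -scalemxAr WW.
    rewrite scalerA -addrA -!scalerDl -[RHS]addr0; congr (_ + _).
    rewrite [X in X *: _](_ : _ = 0) ?scale0r //.
    by rewrite mulrBr mulr1 mulrBl divff //; ring.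
  exists (MkGL ut) => //; rewrite /mx_centralizer /= mulmxDl mulmxDr mul1mx mulmx1.
  by rewrite -scalemxAl -scalemxAr PW.1 PW.2.
have conj c s t : c != 0 -> mx_centralizer s -> mx_centralizer t ->
    GLmx s = 1%:M + U -> GLmx t = 1%:M + c *: U -> chi t = chi s.
  move=> c0 Zs Zt sE teq; have [d deq Zd] := dE c c0.
  have e : (d * s = t * d)%g.
    apply: GLmx_inj; rewrite /= deq sE teq.
    rewrite [RHS]mulmxDr [X in _ = _ + X]mulmxDl [LHS]mulmxDr [X in _ + X = _]mulmxDl.
    rewrite !mul1mx !mulmx1 -!(scalemxAl, scalemxAr) WU UW !scaler0 addr0.
    have -> : U + (c - 1) *: U = c *: U by rewrite scalerBl scale1r addrC subrK.
    by rewrite addrAC.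
  have := congr1 chi e; rewrite !chiM // mulrC => h.
  by apply: (mulIf (chi_neq0 Zd)); rewrite -h.
have [s sE Zs] := tE 1; rewrite scale1r in sE.
have [t teq Zt] := tE x; have [r rE Zr] := tE (1 + x).
have gs : g = s by apply: GLmx_inj; rewrite gE sE.
have rst : r = (s * t)%g.
  apply: GLmx_inj; rewrite /= rE sE teq mulmxDl mul1mx mulmxDr mulmx1.
  by rewrite -scalemxAr UU scaler0 addr0 scalerDl scale1r -addrA [x *: U + U]addrC.
have := chiM Zs Zt; rewrite -rst gs (conj _ _ _ x0 Zs Zt sE teq).
rewrite (conj _ _ _ x1 Zs Zr sE rE) => h.
by apply: (mulfI (chi_neq0 Zs)); rewrite -h mulr1.
Qed.

End Transvections.

(** * The superdiagonal sum, that is [tr (J A)] for [J] the lower shift *)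

Definition superdiag_sum (V : nmodType) n (A : 'M[V]_n) : V :=
  \sum_(i < n) \sum_(j < n | val j == (val i).+1) A i j.

Lemma superdiag_sumD (V : nmodType) n (A B : 'M[V]_n) :
  superdiag_sum (A + B) = superdiag_sum A + superdiag_sum B.
Proof.
rewrite /superdiag_sum -big_split; apply: eq_bigr => i _ /=.
by rewrite -big_split; apply: eq_bigr => j _ /=; rewrite mxE.
Qed.

Lemma superdiag_sumZ (F : pzRingType) n (a : F) (A : 'M[F]_n) :
  superdiag_sum (a *: A) = a * superdiag_sum A.
Proof.
rewrite /superdiag_sum mulr_sumr; apply: eq_bigr => i _ /=.
by rewrite mulr_sumr; apply: eq_bigr => j _ /=; rewrite mxE.
Qed.

Lemma superdiag_sum1 (F : pzRingType) n : superdiag_sum (1%:M : 'M[F]_n) = 0.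
Proof.
apply: big1 => i _; apply: big1 => j /eqP ji; rewrite mxE -val_eqE /= ji.
by rewrite ltn_eqF.
Qed.

(** * The eigencharacter of a congruence subgroup against characters of a large Levi subgroup *)

Section LeviSubgroup.
Variables (R : realType) (F : nonarchLocalFieldType R).
Local Notation absF := (@absF R F).

Lemma superdiag_sum_rank1 n (u : 'cV[F]_n) (xi : 'rV[F]_n) :
  superdiag_sum (u *m xi) = (xi *m lower_shift F n *m u) 0 0.
Proof.
rewrite mxE; apply: eq_bigr => i _; rewrite mxE mulr_suml big_mkcond /=.
apply: eq_bigr => j _; rewrite !mxE big_ord1.
by case: eqP => _; rewrite ?mulr1 ?mulr0 ?mul0r // mulrC.
Qed.

(** The pair [(u, xi)] of [idempotent_witness] gives a transvection [k] in the congruence subgroup,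
    scaled so that the right-hand side is [theta x0], whereas [chi k = 1]. *)
Lemma superdiag_char_not_levi_char (K : idomainType) n (P : 'M[F]_n)
    (chi : GL n F -> K) (theta : F -> K) (x0 a t : F) :
  P *m P = P -> (n.+1 < \rank P + \rank P)%N ->
  (forall g, mx_centralizer P g -> chi g != 0) ->
  (forall g h, mx_centralizer P g -> mx_centralizer P h ->
    chi (g * h)%g = chi g * chi h) ->
  theta x0 != 1 -> t != 0 -> absF x0 <= absF (a * t) ->
  ~ (forall k : GL n F, mx_centralizer P k -> mx_le (absF t) (GLmx k - 1%:M) ->
      chi k = theta (a * superdiag_sum (GLmx k))).
Proof.
move=> PP rP chi0 chiM tx0 t0 x0t H.
have [u [xi [[u1 xi1 Pu xiP] [xu big]]]] := idempotent_witness PP rP.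
set b := (xi *m _ *m u) 0 0 in big.
have b0 : b != 0.
  by apply: contraTneq big => ->; rewrite absF0 -ltNge ltr01.
(* In the degenerate case [x0 = 0], and [H] at the identity gives [theta 0 = 1]. *)
have [a0|an0] := eqVneq (a * t) 0.
  have x00 : x0 = 0.
    by apply/absF_eq0/eqP; rewrite eq_le absF_ge0 andbT (le_trans x0t) // a0 absF0.
  have Z1 : mx_centralizer P 1%g by rewrite /mx_centralizer /= mul1mx mulmx1.
  case/eqP: tx0; rewrite x00.
  have := H 1%g Z1; rewrite /= superdiag_sum1 mulr0 => <-.
    by apply: (mulfI (chi0 _ Z1)); rewrite -chiM // mulg1 mulr1.
  by rewrite subrr; apply: mx_le0; exact: absF_ge0.
have a0 : a != 0 by move: an0; rewrite mulf_eq0 negb_or => /andP[].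
(* Solves [a * (t * y) * b = x0]; it is integral because [1 <= absF b] and
   [absF x0 <= absF (a * t)]. *)
pose y := x0 / (a * t * b).
have yle : absF y <= 1.
  rewrite /y absFM absFV ler_pdivrMr ?absF_gt0 ?mulf_neq0 // mul1r absFM.
  by rewrite (le_trans x0t) // ler_peMr ?absF_ge0.
pose v := (t * y) *: u.
have xv : xi *m v = 0 by rewrite -scalemxAr xu scaler0.
pose k := MkGL (transvection_unit xv).
have kE : GLmx k - 1%:M = (t * y) *: (u *m xi) by rewrite /= addrC addKr scalemxAl.
have Pv : P *m v = v by rewrite -scalemxAr Pu.
have Zk : mx_centralizer P k.
  by rewrite /mx_centralizer /= mulmxDl mulmxDr mul1mx mulmx1 mulmxA Pv -mulmxA xiP.
have [z z0 z1] := @exists_small_absF R F 1 ltr01.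
case/eqP: tx0.
rewrite -(character_transvection PP chi0 chiM z0 (absF_add1_neq0 z1) Pv xiP xv (erefl (GLmx k))).
rewrite H // ?kE; last first.
  apply: mx_le_weaken (scalemx_le (t * y) (mulmx_le1 u1 xi1)).
  by rewrite mulr1 absFM ler_piMr ?absF_ge0.
rewrite -[GLmx k](subrK 1%:M) superdiag_sumD superdiag_sum1 addr0 kE.
rewrite superdiag_sumZ superdiag_sum_rank1 -/b /y.
by congr theta; field; rewrite a0 t0 b0.
Qed.

End LeviSubgroup.

(** * Compactness of balls, and congruence subgroups with their triangular factorisation *)

Section CongruenceSubgroup.
Variables (R : realType) (F : nonarchLocalFieldType R).
Local Notation absF := (@absF R F).

(** Multiplication by a small [t] carries the ball into a compact neighbourhood of 0; a finite cover
    found there is scaled back. *)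
Lemma absF_ball_cover (c e : R) : 0 < e ->
  exists s : seq F, forall x, absF x <= c -> exists2 y, y \in s & absF (x - y) < e.
Proof.
move=> e0.
have [U] := @locally_compactF R F 0 I.
rewrite /prop_near1 nbhs_absF => -[r /= r0 rU] [/compact_near_coveringP cU _].
pose c' := Num.max c 1.
have c'0 : 0 < c' by rewrite lt_max ltr01 orbT.
have [t t0 tr] := @exists_small_absF R F (r / c') (divr_gt0 r0 c'0).
(* The filter of properties that hold for all lists containing a suitable one; compactness, as a
   near-covering property, then yields a single list. *)
pose G : set_system (seq F) := 
  [set A | exists s : seq F, forall s' : seq F, {subset s <= s'} -> A s'].
have FG : Filter G.
  split=> [|A B [s hs] [s' hs']|A B AB [s hs]].
  - by exists [::].
  - exists (s ++ s') => s2 h; split; [apply: hs|apply: hs'] => x xs;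
      by apply: h; rewrite mem_cat xs ?orbT.
  - by exists s => s' h; exact/AB/hs.
pose Q (s : seq F) (x : F) := exists2 y, y \in s & absF (x - y) < absF t * e.
have te : 0 < absF t * e by rewrite mulr_gt0 ?absF_gt0.
have [s hs] : G [set s : seq F | U `<=` Q s].
  apply: (cU _ G Q FG) => x Ux.
  exists ([set y | absF (x - y) < absF t * e], [set s : seq F | x \in s]); first split.
  - by rewrite /= nbhs_absF; exists (absF t * e).
  - by exists [:: x] => s; apply; rewrite mem_head.
  - by case=> y s [/= hy xs]; exists x => //; rewrite -absFN opprB.
exists [seq y / t | y <- s] => x xc.
have [|y ys hy] := hs s (fun _ => id) (t * x).
  apply: rU => //=; rewrite sub0r absFN absFM.
  apply: (@le_lt_trans _ _ (absF t * c')).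
    by rewrite ler_wpM2l ?absF_ge0 // le_max xc.
  by rewrite -ltr_pdivlMr.
exists (y / t); first exact: map_f.
rewrite -(ltr_pM2l (absF_gt0 t0)) -absFM; congr (absF _ < _): hy.
by field.
Qed.

Lemma open_GL_ball n (A : set (GL n F)) : open A -> A 1%g ->
  exists2 e : R, 0 < e & forall g : GL n F,
    (forall i j, absF ((GLmx g - 1%:M) i j) < e) -> A g.
Proof.
case=> B oB <- B1.
have : nbhs (1%:M : 'M[F]_n) B by apply: open_nbhs_nbhs.
case=> Q nQ QB.
have : forall ij : 'I_n * 'I_n, exists e : R, 0 < e /\
    forall y, absF ((1%:M : 'M[F]_n) ij.1 ij.2 - y) < e -> Q ij.1 ij.2 y.
  by move=> [i j]; have := nQ i j; rewrite nbhs_absF => -[e e0 he]; exists e.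
move=> /choice[f hf].
exists (\big[Num.min/1]_ij f ij).
  by elim/big_ind: _ => // [x y x0 y0|ij _]; [rewrite lt_min x0 | exact: (hf ij).1].
move=> g hg; apply: QB => i j.
have := (hf (i, j)).2 (GLmx g i j); apply => /=.
rewrite -absFN opprB; have := hg i j; rewrite !mxE => h; apply: lt_le_trans h _.
exact: bigmin_le.
Qed.

(* An induction that peels off the last row and column, the corner entry being *)
(* the pivot.                                                                  *)
Lemma upper_lower_factor n (c : R) (X : 'M[F]_n) : 0 <= c -> c < 1 ->
  mx_le c (X - 1%:M) -> exists U L : 'M[F]_n,
  [/\ X = U *m L, mx_le c (U - 1%:M), mx_le c (L - 1%:M),
      forall i j : 'I_n, (j <= i)%N -> U i j = (i == j)%:R &
      forall i j : 'I_n, (i < j)%N -> L i j = 0].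
Proof.
move=> c0 c1; elim: n X => [|n IH] X hX.
  by exists 0, 0; split=> [|[]|[]|[]|[]] //; apply/matrixP => -[].
suff: forall X : 'M[F]_(n + 1), mx_le c (X - 1%:M) -> exists U L : 'M[F]_(n + 1),
  [/\ X = U *m L, mx_le c (U - 1%:M), mx_le c (L - 1%:M),
      forall i j : 'I_(n + 1), (j <= i)%N -> U i j = (i == j)%:R &
      forall i j : 'I_(n + 1), (i < j)%N -> L i j = 0].
  by move: X hX; rewrite addn1 => X hX; apply.
move=> {hX}{}X hX.
pose A := ulsubmx X; pose y := ursubmx X; pose z := dlsubmx X.
pose a := drsubmx X 0 0.
have XE : X = block_mx A y z a%:M.
  rewrite -[LHS]submxK; congr block_mx.
  by apply/matrixP => i j; rewrite !ord1 [RHS]mxE eqxx mulr1n.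
have X1 : X - 1%:M = block_mx (A - 1%:M) y z (a%:M - 1%:M).
  rewrite XE (scalar_mx_block n 1) opp_block_mx add_block_mx.
  by rewrite !oppr0 !addr0.
rewrite X1 in hX.
have hA : mx_le c (A - 1%:M).
  by move=> i j; have := hX (lshift 1 i) (lshift 1 j); rewrite block_mxEul.
have hy : mx_le c y.
  by move=> i j; have := hX (lshift 1 i) (rshift n j); rewrite block_mxEur.
have hz : mx_le c z.
  by move=> i j; have := hX (rshift n i) (lshift 1 j); rewrite block_mxEdl.
have ha : absF (a - 1) <= c.
  by have := hX (rshift n 0) (rshift n 0); rewrite block_mxEdr !mxE !eqxx.
have a1 : absF a = 1.
  by rewrite -[a](subrK 1) addrC absF_add1 // (le_lt_trans ha).
have a0 : a != 0 by apply: contra_eq_neq a1 => ->; rewrite absF0 eq_sym oner_eq0.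
have hya : mx_le c (a^-1 *: y).
  by move=> i j; rewrite mxE absFM absFV a1 invr1 mul1r.
(* The Schur complement of [a] stays within [c] of the identity, since [absF a = 1] and
   [c * c <= c]. *)
have hA' : mx_le c ((A - a^-1 *: y *m z) - 1%:M).
  rewrite addrAC => i j; rewrite mxE absFD_le // mxE absFN.
  apply: (@le_trans _ _ (c * c)); first exact: mulmx_le.
  by rewrite ler_piMr // ltW.
have [U [L [ULE hU hL Uu Ll]]] := IH _ hA'.
have b1 : 1%:M = block_mx 1%:M 0 0 1%:M :> 'M[F]_(n + 1) by exact: scalar_mx_block.
exists (block_mx U (a^-1 *: y) 0 1%:M), (block_mx L 0 z a%:M); split.
- rewrite mulmx_block XE !(mulmx0, mul0mx, add0r, mul1mx, mulmx1).
  rewrite -ULE subrK; congr block_mx.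
  by rewrite mul_mx_scalar scalerA divff // scale1r.
- rewrite b1 opp_block_mx add_block_mx !oppr0 !addr0 subrr.
  by apply: mx_le_block => //; exact: mx_le0.
- rewrite b1 opp_block_mx add_block_mx !oppr0 !addr0.
  apply: mx_le_block => //; first exact: mx_le0.
  by move=> i j; rewrite !ord1 !mxE !eqxx.
- move=> i j; case: (split_ordP i) => i' ->; case: (split_ordP j) => j' -> /=.
  + by rewrite block_mxEul (inj_eq (@lshift_inj _ _)) => /Uu.
  + by rewrite !ord1 /= addn0 leqNgt ltn_ord.
  + by rewrite block_mxEdl mxE eq_rlshift.
  + by rewrite block_mxEdr mxE (inj_eq (@rshift_inj _ _)).
- move=> i j; case: (split_ordP i) => i' ->; case: (split_ordP j) => j' -> /=.
  + by rewrite block_mxEul => /Ll.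
  + by rewrite block_mxEur mxE.
  + by rewrite !ord1 /= addn0 ltnNge ltnW.
  + by rewrite !ord1 ltnn.
Qed.

Definition congruence_subgroup n (c : R) : set (GL n F) :=
  [set g | mx_le c (GLmx g - 1%:M)].

Lemma congruence_subgroup_le1 n c (g : GL n F) : c <= 1 ->
  congruence_subgroup c g -> mx_le 1 (GLmx g).
Proof.
move=> c1 hg; rewrite -[GLmx g](subrK 1%:M).
exact: addmx_le (mx_le_weaken c1 hg) (@mx_le1 _ _ _).
Qed.

Lemma congruence_subgroupM n c (g h : GL n F) : 0 <= c -> c <= 1 ->
  congruence_subgroup c g -> congruence_subgroup c h -> congruence_subgroup c (g * h)%g.
Proof.
move=> c0 c1 hg hh; rewrite /congruence_subgroup /=.
have -> : GLmx g *m GLmx h - 1%:M = GLmx g *m (GLmx h - 1%:M) + (GLmx g - 1%:M).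
  by rewrite mulmxBr mulmx1 addrA subrK.
apply: (addmx_le _ hg); rewrite -[c]mul1r; apply: mulmx_le => //.
exact: congruence_subgroup_le1 hg.
Qed.

(** The inverse satisfies [Y = 1 - (g - 1) Y], so its largest entry, if it exceeded 1, would be
    strictly smaller than itself. *)
Lemma congruence_subgroup_inv_le1 n c (g : GL n F) : 0 <= c -> c < 1 ->
  congruence_subgroup c g -> mx_le 1 (invmx (GLmx g)).
Proof.
move=> c0 c1 hg i j; rewrite leNgt; apply/negP => hij.
set Y := invmx _ in hij *.
pose ij := [arg max_(u > (i, j)) absF (Y u.1 u.2)]%O.
have ijP u v : absF (Y u v) <= absF (Y ij.1 ij.2).
  by rewrite /ij; case: arg_maxP => // w _ /(_ (u, v)); apply.
set m := absF (Y ij.1 ij.2) in ijP.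
have m1 : 1 < m := lt_le_trans hij (ijP i j).
have : Y = 1%:M - (GLmx g - 1%:M) *m Y.
  by rewrite mulmxBl mul1mx mulmxV ?GLmx_unit // opprB addrC subrK.
move=> /matrixP/(_ ij.1 ij.2); rewrite [RHS]mxE [X in _ + X]mxE => h.
suff: m < m by rewrite ltxx.
rewrite {1}/m h; apply: absFB_lt.
  by apply: le_lt_trans m1; exact: mx_le1.
apply: (@le_lt_trans _ _ (c * m)).
  by apply: mulmx_le => //; exact: absF_ge0.
by rewrite gtr_pMl // (lt_trans ltr01 m1).
Qed.

End CongruenceSubgroup.

(** * Eigenvectors of congruence subgroups in generic representations *)

Section CongruenceEigenvector.
Variables (R : realType) (F : nonarchLocalFieldType R).
Local Notation absF := (@absF R F).
Local Notation C := R[i].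

Lemma superdiag_sum_le n (c : R) (A : 'M[F]_n) : 0 <= c ->
  mx_le c A -> absF (superdiag_sum A) <= c.
Proof. by move=> c0 hA; do 2![apply: absF_sum_le => // ? _]; exact: hA. Qed.

(* The vector is the sum of the orbit of [w] under the action of the compact   *)
(* congruence subgroup twisted by [psi^-1]; the orbit is finite by smoothness. *)
Lemma congruence_eigenvector n (V : lmodType C) (rho : smooth_rep F n V)
    (c e1 : R) (psi : GL n F -> C) (lam : V -> C) (w : V) (l0 : C) :
  0 <= c -> c < 1 -> 0 < e1 ->
  (forall k, psi k != 0) ->
  (forall g h, congruence_subgroup c g -> congruence_subgroup c h ->
    psi (g * h)%g = psi g * psi h) ->
  (forall g h : GL n F, mx_le e1 (GLmx g - GLmx h) -> psi g = psi h) ->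
  (forall x y, lam (x + y) = lam x + lam y) ->
  (forall k, congruence_subgroup c k -> lam ((psi k)^-1 *: rho k w) = l0) ->
  l0 != 0 ->
  exists2 v, v != 0 &
    forall k, congruence_subgroup c k -> rho k v = psi k *: v.
Proof.
move=> c0 c1 e10 psi0 psiM psiloc lamD lamE l00.
pose act k x := (psi k)^-1 *: rho k x.
pose E := [set act k w | k in [set k : GL n F | congruence_subgroup c k]].
have [e2 e20 he2] : exists2 e : R, 0 < e & forall g : GL n F,
    (forall i j, absF ((GLmx g - 1%:M) i j) < e) -> rho g w = w.
  by apply: open_GL_ball (rep_smooth rho w) (rep_act1 rho w).
have e0 : 0 < Num.min e1 e2 by rewrite lt_min e10.
have [s hs] := absF_ball_cover F 1 e0.
(* For close [g] and [h], the element [h^-1 g] is near 1 because [h^-1] is integral, so it fixes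
   [w]. *)
have actE g h : congruence_subgroup c g -> congruence_subgroup c h ->
    (forall i j, absF ((GLmx g - GLmx h) i j) < Num.min e1 e2) -> act g w = act h w.
  move=> Kg Kh hgh; rewrite /act (psiloc g h); last first.
    by move=> i j; apply: ltW; apply: lt_le_trans (hgh i j) _; rewrite ge_min lexx.
  congr (_ *: _); rewrite -[g](mulVKg h) rep_actM he2 // => i j.
  rewrite /= -[1%:M](mulVmx (GLmx_unit h)) -mulmxBr mxE absF_sum_lt // => r _.
  rewrite absFM; apply: (@le_lt_trans _ _ (absF ((GLmx g - GLmx h) r j))).
    by rewrite ler_piMl ?absF_ge0 // (congruence_subgroup_inv_le1 c0 c1 Kh).
  by apply: lt_le_trans (hgh r j) _; rewrite ge_min lexx orbT.
(* Each [k] is coded by the cover points near its entries; there are finitely many codes, and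
   elements sharing a code act equally on [w]. *)
have finE : finite_set E.
  pose near_mx (f : {ffun 'I_n * 'I_n -> 'I_(size s)}) (k : GL n F) :=
    congruence_subgroup c k /\
    forall i j, absF (GLmx k i j - nth 0 s (f (i, j))) < Num.min e1 e2.
  have pick k : congruence_subgroup c k -> exists f, near_mx f k.
    move=> Kk.
    have : forall ij : 'I_n * 'I_n, exists a : 'I_(size s),
        absF (GLmx k ij.1 ij.2 - nth 0 s a) < Num.min e1 e2.
      move=> [i j].
      have [y ys hy] := hs _ (congruence_subgroup_le1 (ltW c1) Kk i j).
      move: (ys); rewrite -index_mem => lt.
      by exists (Ordinal lt); rewrite (nth_index _ ys); exact: hy.
    by move=> /choice[f hf]; exists [ffun ij => f ij]; split=> // i j;
      rewrite ffunE; exact: (hf (i, j)).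
  pose rep f := xget 1%g (near_mx f).
  apply: (@sub_finite_set _ _ [set act (rep f) w | f in setT]); last first.
    by apply: finite_image; exact: finite_finset.
  move=> _ [k Kk <-]; have [f hf] := pick k Kk; exists f => //.
  have [Kr hr] : near_mx f (rep f) by apply: xgetPex; exists k.
  apply: actE => // i j; rewrite [absF _](_ : _ = absF
    ((rep f : GL n F) i j - nth 0 s (f (i, j)) - (GLmx k i j - nth 0 s (f (i, j))))).
    by apply: absFB_lt; [exact: hr | exact: hf.2].
  by rewrite !mxE; congr absF; ring.
have /finite_seqP[t0 Et0] := finE.
pose t := undup t0.
have Et x : E x <-> x \in t by rewrite Et0 /= mem_undup.
have K1 : congruence_subgroup c (1%g : GL n F).
  by rewrite /congruence_subgroup /= subrr; exact: mx_le0.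
have lamt (r : seq V) : (forall x, x \in r -> lam x = l0) ->
    lam (\sum_(x <- r) x) = l0 *+ size r.
  elim: r => [|x r IH] hr.
    by rewrite big_nil mulr0n; apply: (addrI (lam 0)); rewrite -lamD !addr0.
  rewrite big_cons lamD hr ?mem_head // IH ?mulrS // => y yr.
  by rewrite hr // inE yr orbT.
(* [lam] is [l0] on every orbit element, so on the sum it is a positive multiple of [l0], nonzero in
   characteristic 0. *)
exists (\sum_(x <- t) x).
  apply/eqP => v0; have := lamt t; rewrite v0.
  have -> : lam 0 = 0 by apply: (addrI (lam 0)); rewrite -lamD !addr0.
  move=> h; have /eqP : 0 = l0 *+ size t.
    by apply: h => x /Et[k Kk <-]; exact: lamE.
  rewrite eq_sym mulrn_eq0 (negPf l00) orbF size_eq0 => /eqP t_nil.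
  have : act 1%g w \in t by apply/Et; exists 1%g.
  by rewrite t_nil.
move=> k Kk.
have actinj : injective (act k).
  move=> x y; rewrite /act => h.
  have {}h : rho k x = rho k y by apply: (scalerI (invr_neq0 (psi0 k))).
  by rewrite -[x](rep_act1 rho) -[y](rep_act1 rho) -(mulVg k) !rep_actM h.
have ut : uniq t by exact: undup_uniq.
(* The twisted action permutes the orbit, listed in [t] without repetition. *)
have perm : perm_eq (map (act k) t) t.
  have um : uniq (map (act k) t) by rewrite map_inj_uniq.
  apply: uniq_perm => //.
  have sub : {subset map (act k) t <= t}.
    move=> _ /mapP[x /Et[h Kh <-] ->]; apply/Et; exists (k * h)%g.
      exact: congruence_subgroupM (ltW c1) Kk Kh.
    by rewrite /act psiM // rep_actM linearZ /= scalerA invfM.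
  by have [|_ ] := uniq_min_size um sub; rewrite ?size_map.
rewrite -[LHS](scalerKV (psi0 k)); congr (_ *: _).
rewrite [LHS](_ : _ = \sum_(x <- map (act k) t) x); first exact: perm_big.
by rewrite big_map raddf_sum scaler_sumr.
Qed.

Lemma additive_character_ball (theta : F -> C) : is_additive_character theta ->
  exists2 c0, c0 != 0 & forall x, absF x <= absF c0 -> theta x = 1.
Proof.
case=> t0 tD tloc.
have tz : theta 0 = 1 by apply: (mulfI (t0 0)); rewrite -tD addr0 mulr1.
have := tloc 0; rewrite /prop_near1 nbhs_absF => -[e /= e0 he].
have [c0 c00 c0e] := @exists_small_absF R F e e0.
exists c0 => // x hx; rewrite -tz; apply: he => /=.
by rewrite sub0r absFN (le_lt_trans hx).
Qed.

(** Conjugation by it multiplies the entry [(i, j)] by [s ^ (i - j)]: superdiagonal entries by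
    [s^-1], those below the diagonal by positive powers of [s]. *)
Definition torus_mx n (s : F) : 'M[F]_n := diag_mx (\row_i s ^+ i).

Lemma torus_mxV n s : s != 0 -> torus_mx n s *m torus_mx n s^-1 = 1%:M.
Proof.
move=> s0; rewrite mul_diag_mx; apply/matrixP => i j; rewrite !mxE.
have [->|_] := eqVneq i j; last by rewrite !mulr0n mulr0.
by rewrite !mulr1n exprVn divff // expf_neq0.
Qed.

Lemma generic_eigenvector n (theta : F -> C) (V : lmodType C)
    (rho : smooth_rep F n V) (x0 : F) :
  is_additive_character theta -> generic_rep theta rho ->
  exists (a t : F) (v : V),
    [/\ t != 0, absF x0 <= absF (a * t), v != 0 &
      forall k, congruence_subgroup (absF t) k ->
        rho k v = theta (a * superdiag_sum (GLmx k)) *: v].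
Proof.
move=> chth [[[v1 v1n0] irr] [T [injT indT eqT]]].
have [th0 thD _] := chth.
have [c0 c00 hc0] := additive_character_ball chth.
(* The Whittaker functional, obtained by evaluating at the identity. *)
pose lam v := T v 1%g.
have lamD x y : lam (x + y) = lam x + lam y by rewrite /lam raddfD.
have lamZ b x : lam (b *: x) = b * lam x by rewrite /lam linearZ.
have lamN (u : GL n F) v : unipotent_upper u ->
    lam (rho u v) = theta (superdiag_sum (GLmx u)) * lam v.
  move=> hu; rewrite /lam eqT /right_translate mul1g -[u in LHS]mulg1.
  by rewrite (indT v).1.
have [v0 lv0] : exists v0, lam v0 != 0.
  apply: contrapT => /forallNP h; case/eqP: v1n0; apply: injT; rewrite raddf0.
  apply/funext => g; have /negP := h (rho g v1); rewrite negbK => /eqP.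
  by rewrite /lam eqT /right_translate mul1g.
have [e0 e00 he0] : exists2 e : R, 0 < e & forall g : GL n F,
    (forall i j, absF ((GLmx g - 1%:M) i j) < e) -> rho g v0 = v0.
  by apply: open_GL_ball (rep_smooth rho v0) (rep_act1 rho v0).
have ac0 : 0 < absF c0 := absF_gt0 c00.
have x01 : 0 < absF x0 + 1 by rewrite ltr_wpDl ?absF_ge0.
have q0 : 0 < absF c0 / (absF x0 + 1) by rewrite divr_gt0.
have [|t t0] := @exists_small_absF R F (Num.min (Num.min 1 e0) (absF c0 / (absF x0 + 1))).
  by rewrite !lt_min ltr01 e00.
rewrite !lt_min => /andP[/andP[t1 te0]]; rewrite ltr_pdivlMr // => tc0.
have at0 := absF_gt0 t0.
have tc0' : absF t <= absF c0.
  by apply: le_trans (ltW tc0); rewrite ler_peMr ?absF_ge0 // lerDr absF_ge0.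
have tx0 : absF x0 * absF t <= absF c0.
  by apply: le_trans (ltW tc0); rewrite mulrC ler_wpM2l ?absF_ge0 // lerDl.
(* Chosen so that [a * t ^+ 2 = c0]: then [theta (a * x) = 1] for [absF x <= absF t ^+ 2], while
   [absF (a * t) = absF c0 / absF t] is at least [absF x0]. *)
pose s := t ^+ 2 / c0; pose a := s^-1.
have s0 : s != 0 by rewrite mulf_neq0 ?invr_eq0 ?expf_neq0.
have as1 : absF s <= 1.
  rewrite absFM absFV ler_pdivrMr // mul1r absFX expr2.
  by apply: le_trans tc0'; rewrite ler_piMr ?absF_ge0 // ltW.
have aE : a * (t * t) = c0 by rewrite /a /s; field; rewrite c00 t0.
pose psi (k : GL n F) := theta (a * superdiag_sum (GLmx k)).
have thz : theta 0 = 1 by apply: hc0; rewrite absF0 absF_ge0.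
have small x : absF x <= absF t * absF t -> theta (a * x) = 1.
  by move=> hx; apply: hc0; rewrite -aE 2!absFM [absF (t * t)]absFM ler_wpM2l ?absF_ge0.
have psiM g h : congruence_subgroup (absF t) g -> congruence_subgroup (absF t) h ->
    psi (g * h)%g = psi g * psi h.
  move=> Kg Kh; rewrite /psi -thD -mulrDr -superdiag_sumD /=.
  (* The product of the two differences has entries of size at most [absF t ^+ 2], on which
     [theta (a * _)] is trivial. *)
  have -> : GLmx g *m GLmx h =
      (GLmx g - 1%:M) *m (GLmx h - 1%:M) + (GLmx g + GLmx h) + (-1) *: 1%:M.
    rewrite mulmxBl mulmxBr mulmx1 mul1mx; move: (GLmx g *m GLmx h) => A.
    by apply/matrixP => i j; rewrite !mxE; ring.
  rewrite !superdiag_sumD superdiag_sumZ superdiag_sum1 mulr0 addr0.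
  rewrite mulrDr thD (small (superdiag_sum (_ *m _))) ?mul1r //.
  apply: superdiag_sum_le.
    by rewrite mulr_ge0 ?absF_ge0.
  by apply: mulmx_le => //; exact: absF_ge0.
have psiloc (g h : GL n F) :
    mx_le (absF t * absF t) (GLmx g - GLmx h) -> psi g = psi h.
  move=> hgh; rewrite /psi -[GLmx g](subrK (GLmx h)) superdiag_sumD mulrDr thD.
  by rewrite small ?mul1r //; apply: superdiag_sum_le; rewrite ?mulr_ge0 ?absF_ge0.
have dV := torus_mxV n s0.
have [dU _] := mulmx1_unit dV.
pose d := MkGL dU.
have dVE : GLmx d^-1%g = torus_mx n s^-1.
  by rewrite /= -[LHS]mulmx1 -dV mulKmx.
have dE (k : GL n F) i j :
    GLmx (d * k * d^-1)%g i j = s ^+ i * GLmx k i j * s^-1 ^+ j.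
  transitivity ((torus_mx n s *m GLmx k *m GLmx d^-1%g) i j) => //.
  by rewrite dVE mul_mx_diag mul_diag_mx !mxE.
pose lamd v := lam (rho d v).
have [||v vn0 hv] := @congruence_eigenvector n V rho (absF t) (absF t * absF t)
   psi lamd (rho d^-1%g v0) (lam v0) (absF_ge0 t) t1 (mulr_gt0 at0 at0)
   (fun k => th0 _) psiM psiloc _ _ lv0; last 1 first.
- exists a, t, v; split => //.
  by rewrite -(ler_pM2r at0) -!absFM -mulrA aE absFM.
- by move=> x y; rewrite /lamd raddfD lamD.
move=> k Kk; rewrite /lamd linearZ lamZ -!rep_actM mulgA.
have [U [L [kUL hU hL Uu Ll]]] := upper_lower_factor (absF_ge0 t) t1 Kk.
have := GLmx_unit k; rewrite kUL unitmx_mul => /andP[uU uL].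
pose u := MkGL uU; pose l := MkGL uL.
have kE : k = (u * l)%g by apply: GLmx_inj.
have psil : psi l = 1.
  rewrite /psi [superdiag_sum _](_ : _ = 0) ?mulr0 //.
  by apply: big1 => i _; apply: big1 => j /eqP ji; rewrite /= Ll // ji.
have -> : (d * k * d^-1 = (d * u * d^-1) * (d * l * d^-1))%g.
  by rewrite kE !mulgA mulgVK.
(* Conjugation by [d] keeps the diagonal of the lower triangular [l] and does not enlarge the
   entries below it, so the conjugate stays within [absF t < e0] of 1 and fixes [v0]. *)
have -> : rho ((d * u * d^-1) * (d * l * d^-1))%g v0 = rho (d * u * d^-1)%g v0.
  rewrite rep_actM he0 // => i j; rewrite mxE dE !mxE.
  have [lij|lij|/val_inj ->] := ltngtP i j.
  - rewrite /= Ll // mulr0 mul0r -val_eqE ltn_eqF // subr0 absF0 //.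
  - rewrite -val_eqE gtn_eqF // subr0 /=.
    apply: le_lt_trans te0; rewrite mulrAC.
    have -> : s ^+ i * s^-1 ^+ j = s ^+ (i - j).
      by rewrite -{1}(subnK (ltnW lij)) exprD -mulrA -exprMn divff // expr1n mulr1.
    rewrite absFM.
    have := hL i j; rewrite !mxE -val_eqE gtn_eqF // subr0 => h.
    apply: le_trans h; rewrite ler_piMl ?absF_ge0 // absFX exprn_ile1 ?absF_ge0 //.
  - rewrite mulrAC -exprMn divff // expr1n mul1r.
    by apply: le_lt_trans te0; have := hL j j; rewrite !mxE.
have ud : unipotent_upper (d * u * d^-1)%g.
  move=> i j ji; rewrite dE /= Uu //.
  have [->|_] := eqVneq i j; last by rewrite mulr0 mul0r.
  by rewrite mulr1 -exprMn divff // expr1n.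
rewrite lamN // kE psiM // psil mulr1 mulrA.
have -> : superdiag_sum (GLmx (d * u * d^-1)%g) = a * superdiag_sum (GLmx u).
  rewrite /superdiag_sum mulr_sumr; apply: eq_bigr => i _.
  rewrite mulr_sumr; apply: eq_bigr => j /eqP ji; rewrite dE ji exprSr.
  by rewrite mulrAC mulrA -exprMn divff // expr1n mul1r.
by rewrite mulVf ?mul1r ?th0.
Qed.

End CongruenceEigenvector.

(** * Bounding the block sizes of a distinguishing Levi subgroup *)

Lemma std_levi_idempotent (F : fieldType) n p q : (p + q)%N = n ->
  exists P : 'M[F]_n, [/\ P *m P = P, \rank P = p &
    mx_centralizer P `<=` @std_levi F n p q].
Proof.
move=> e; subst n; exists (block_mx 1%:M 0 0 0); split.
- by rewrite mulmx_block !(mulmx0, mul0mx, addr0, mulmx1).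
- have -> : block_mx 1%:M 0 0 0 = pid_mx p :> 'M[F]_(p + q) by rewrite pid_mx_block.
  by rewrite rank_pid_mx // leq_addr.
(* Commuting with [P] kills the off-diagonal blocks, and invertibility of [g] passes to the diagonal
   ones. *)
move=> g; rewrite /mx_centralizer /=.
have ug := GLmx_unit g.
rewrite -{1 2}[GLmx g]submxK !mulmx_block.
rewrite !(mulmx0, mul0mx, addr0, add0r, mulmx1, mul1mx) => /eq_block_mx[_ B0 C0 _].
have gE : GLmx g = block_mx (ulsubmx (GLmx g)) 0 0 (drsubmx (GLmx g)).
  by rewrite -{1}[GLmx g]submxK -B0 C0.
have := ug; rewrite {1}gE unitmxE det_ublock unitrM -!unitmxE => /andP[uA uD].
by exists erefl, (MkGL uA), (MkGL uD); rewrite castmx_id.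
Qed.

Lemma generic_distinguished_levi_size (R : realType) (F : nonarchLocalFieldType R)
    (n p q : nat) (theta : F -> R[i]) (V : lmodType R[i]) (pi : smooth_rep F n V)
    (L : set (GL n F)) (mu : GL n F -> R[i]) :
  nontrivial_additive_character theta -> generic_rep theta pi ->
  (p + q)%N = n -> conjugate_to L (std_levi p q) -> is_character L mu ->
  distinguished pi L mu -> (p <= q.+1)%N.
Proof.
move=> [chth [x0 thx0]] gen pqn [g0 LE] [mu0 muM _] [l [lmu [vl lvl]]].
rewrite leqNgt; apply/negP => qp.
have [a [t [v [t0 x0t vn0 hv]]]] := generic_eigenvector x0 chth gen.
(* The vectors all of whose translates are killed by [l] form a subrepresentation; by irreducibility
   it is zero, as [l] is not. *)
have [g lg] : exists g, l (pi g v) != 0.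
  apply: contrapT => /forallNP h.
  pose W : {pred V} := [pred x | `[< forall g, l (pi g x) = 0 >]].
  have WP x : reflect (forall g, l (pi g x) = 0) (x \in W) by exact: asboolP.
  have [||W0|WT] := gen.1.2 W.
  - split; first by apply/WP => g; rewrite !linear0.
    move=> b x y /WP hx /WP hy; apply/WP => g.
    by rewrite !linearP hx hy scaler0 addr0.
  - by move=> g x /WP hx; apply/WP => k; rewrite -rep_actM.
  - case/eqP: vn0; apply: W0; apply/WP => g.
    by have /negP := h g; rewrite negbK => /eqP.
  - case/eqP: lvl; have /WP/(_ 1%g) := WT vl; by rewrite rep_act1.
have [P0 [P0P rP0 Zsub]] := std_levi_idempotent F pqn.
have [h hE] : exists h, h = (g0^-1 * g)%g by eexists.
(* Conjugated so that [g] carries the centralizer of [P] into [L]. *)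
pose P := invmx (GLmx h) *m P0 *m GLmx h.
have uh := GLmx_unit h.
have PP : P *m P = P.
  by rewrite /P !mulmxA mulmxK // -[_ *m P0 *m P0]mulmxA P0P.
have rP : \rank P = p.
  rewrite /P mxrankMfree ?row_free_unit // -rP0.
  by rewrite eqmxMfull // row_full_unit unitmx_inv.
have ZL k : mx_centralizer P k -> L (g * k * g^-1)%g.
  rewrite /mx_centralizer /= /P => Zk; rewrite LE.
  exists (h * k * h^-1)%g; last by rewrite hE invgM invgK !mulgA mulgV mul1g mulgK.
  apply: Zsub; rewrite /mx_centralizer /=.
  have := congr1 (fun M => GLmx h *m M *m invmx (GLmx h)) Zk.
  by rewrite !mulmxA mulmxK // mulmxV // mul1mx => ->.
pose chi k := mu (g * k * g^-1)%g.
have chi0 k : mx_centralizer P k -> chi k != 0 by move=> Zk; exact/mu0/ZL.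
have chiM k k' : mx_centralizer P k -> mx_centralizer P k' ->
    chi (k * k')%g = chi k * chi k'.
  move=> Zk Zk'; rewrite /chi -muM; [|exact: ZL..].
  by rewrite !mulgA mulgVK.
apply: (superdiag_char_not_levi_char PP _ chi0 chiM thx0 t0 x0t); first by rewrite rP; lia.
(* Evaluating [l (pi (g k) v)] through [L] and through the eigenvector [v] equates the two
   characters, as [l (pi g v)] is nonzero. *)
move=> k Zk Kk; have := lmu _ (pi g v) (ZL k Zk).
rewrite -rep_actM mulgVK rep_actM hv // !linearZ => /(mulIf lg) ->.
by [].
Qed.


Theorem theorem3p2 (R : realType) (F : nonarchLocalFieldType R) (n : nat)
    (theta : F -> R[i]) (htheta : nontrivial_additive_character theta)
    (V : lmodType R[i]) (pi : smooth_rep F n V) (hpi : generic_rep theta pi)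
    (L : set (GL n F)) (hL : maximal_levi L)
    (mu : GL n F -> R[i]) (hmu : is_character L mu)
    (hdist : distinguished pi L mu) :
  (~~ odd n -> conjugate_to L (@std_levi F n n./2 n./2)) /\
  (odd n -> conjugate_to L (@std_levi F n n.+1./2 n.-1./2)).
Proof.
have [p [q [pqn qp _ hc]]] := hL.
have pq1 := generic_distinguished_levi_size htheta hpi pqn hc hmu hdist.
(* From [q <= p <= q + 1] and [p + q = n], the parity of [n] determines [p] and [q]. *)
by split=> hn; [have -> : n./2 = p by lia | have -> : n.+1./2 = p by lia];
  [have {2}-> : p = q by lia | have -> : n.-1./2 = q by lia].
Qed.
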